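(* Let $X$ be a non-empty set, $(K,\le)$ a totally preordered set, and $\Phi:X\to\operatorname{seq}(K)$ a mapping. Then the $\Phi$-sequential binary relation $\le_\Phi$ on $X$, defined by $x\le_\Phi y \iff \Phi(x)\sqsubseteq\Phi(y)$, is a total preorder on $X$.
   Context: A total preorder is a reflexive, transitive relation in which any two elements are comparable. For a totally preordered set $(K,\le)$ write $u\sim v$ if $u\le v$ and $v\le u$, and $u<v$ if $u\le v$ and not $v\le u$. Let $\mathbb{N}_0=\{0,1,2,\dots\}$ and let $\operatorname{seq}(K)=K^{\mathbb{N}_0}$ be the set of all sequences $\mathfrak a=\{a_n\}_{n\in\mathbb{N}_0}$ in $K$. Write $\mathfrak a\equiv\mathfrak b$ when $a_n\sim b_n$ for all $n\in\mathbb{N}_0$. Define $\mathfrak a\sqsubseteq\mathfrak b$ when one, and only one, of the following holds: (1) $\mathfrak a\equiv\mathfrak b$; (2) there is $n_0\in\mathbb{N}_0$ such that $a_n\sim b_n$ for all $n<n_0$ and $a_{n_0}<b_{n_0}$ (for $n_0=0$ this just means $a_0<b_0$). *)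

(* Defs.v *)
From Stdlib Require Export Relation_Definitions.

(* [relation A] is [A -> A -> Prop]; [preorder] is reflexive and transitive. *)
Definition total_preorder {A : Type} (R : relation A) : Prop :=
  preorder A R /\ forall x y : A, R x y \/ R y x.

Definition equiv_of {A : Type} (R : relation A) : relation A :=
  fun u v => R u v /\ R v u.

Definition strict_of {A : Type} (R : relation A) : relation A :=
  fun u v => R u v /\ ~ R v u.

Definition seqs (K : Type) : Type := nat -> K.

Definition seq_equiv {K : Type} (le : relation K) : relation (seqs K) :=
  fun a b => forall n : nat, equiv_of le (a n) (b n).

Definition seq_lt {K : Type} (le : relation K) : relation (seqs K) :=
  fun a b => exists n0 : nat,
    (forall n : nat, n < n0 -> equiv_of le (a n) (b n)) /\
    strict_of le (a n0) (b n0).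

Definition exactly_one (P Q : Prop) : Prop := (P /\ ~ Q) \/ (~ P /\ Q).

Definition seq_le {K : Type} (le : relation K) : relation (seqs K) :=
  fun a b => exactly_one (seq_equiv le a b) (seq_lt le a b).

Definition sequential_rel {X K : Type} (le : relation K) (Phi : X -> seqs K) :
    relation X :=
  fun x y => seq_le le (Phi x) (Phi y).

(* Main.v *)
(** Alternatives (1) and (2) exclude each other, so [seq_le] is the plain
    disjunction of [seq_equiv] and [seq_lt]. Comparability comes from looking at
    the first index where the sequences are not equivalent, and transitivity
    from the smaller of the two such indices. *)

From Stdlib Require Import Classical Arith Lia.
Require Import Defs.

Lemma equiv_of_refl {A : Type} (R : relation A) (hR : preorder A R) (x : A) :
  equiv_of R x x.
Proof. destruct hR as [Rrefl _]; split; apply Rrefl. Qed.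

Lemma equiv_of_sym {A : Type} (R : relation A) (x y : A) :
  equiv_of R x y -> equiv_of R y x.
Proof. unfold equiv_of; tauto. Qed.

Lemma equiv_of_trans {A : Type} (R : relation A) (hR : preorder A R)
    (x y z : A) :
  equiv_of R x y -> equiv_of R y z -> equiv_of R x z.
Proof.
  destruct hR as [_ Rtrans]; intros [xy yx] [yz zy].
  split; apply Rtrans with y; assumption.
Qed.

(** A comparison [R z x] would compose with [R y z] to give [R y x], which the strict hypothesis
    denies. *)
Lemma strict_equiv_trans {A : Type} (R : relation A) (hR : preorder A R)
    (x y z : A) :
  strict_of R x y -> equiv_of R y z -> strict_of R x z.
Proof.
  destruct hR as [_ Rtrans]; intros [xy nyx] [yz zy]; split.
  - apply Rtrans with y; assumption.
  - intros zx; apply nyx, Rtrans with z; assumption.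
Qed.

Lemma equiv_strict_trans {A : Type} (R : relation A) (hR : preorder A R)
    (x y z : A) :
  equiv_of R x y -> strict_of R y z -> strict_of R x z.
Proof.
  destruct hR as [_ Rtrans]; intros [xy yx] [yz nzy]; split.
  - apply Rtrans with y; assumption.
  - intros zx; apply nzy, Rtrans with x; assumption.
Qed.

Lemma strict_of_trans {A : Type} (R : relation A) (hR : preorder A R)
    (x y z : A) :
  strict_of R x y -> strict_of R y z -> strict_of R x z.
Proof.
  destruct hR as [_ Rtrans]; intros [xy nyx] [yz nzy]; split.
  - apply Rtrans with y; assumption.
  - intros zx; apply nyx, Rtrans with z; assumption.
Qed.

(** Totality supplies one comparison; the reverse one would then complete an equivalence. *)
Lemma not_equiv_strict {A : Type} (R : relation A) (hR : total_preorder R)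
    (x y : A) :
  ~ equiv_of R x y -> strict_of R x y \/ strict_of R y x.
Proof.
  destruct hR as [_ Rtotal]; unfold equiv_of, strict_of.
  destruct (Rtotal x y); tauto.
Qed.

(** Classical: if no such [n0] existed, [P] would pass from all smaller indices to the next, hence
    hold everywhere by strong induction. *)
Lemma least_counterexample (P : nat -> Prop) :
  ~ (forall n, P n) -> exists n0, (forall n, n < n0 -> P n) /\ ~ P n0.
Proof.
  intros nP; apply NNPP; intros none; apply nP.
  intros n; induction n as [n IH] using (well_founded_induction lt_wf).
  apply NNPP; intros nPn; apply none; exists n; split; assumption.
Qed.

Section SeqLe.

Context {K : Type} (le : relation K).

Lemma seq_leP (a b : seqs K) :
  seq_le le a b <-> seq_equiv le a b \/ seq_lt le a b.
Proof.
  assert (excl : ~ (seq_equiv le a b /\ seq_lt le a b)).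
  (* At the witness [n], equivalence provides the very comparison of [b n] with [a n] that
     strictness refutes. *)
  { intros [E [n [_ [_ nba]]]]; apply nba, (E n). }
  unfold seq_le, exactly_one; tauto.
Qed.

Lemma seq_lt_trans (hle : preorder K le) (a b c : seqs K) :
  seq_lt le a b -> seq_lt le b c -> seq_lt le a c.
Proof.
  intros [m [Em Lm]] [n [En Ln]]; exists (Nat.min m n); split.
  - intros k Hk; apply (equiv_of_trans le hle _ (b k)).
    + apply Em; lia.
    + apply En; lia.
  (* At the smaller index one pair is strict and the other still equivalent; if the indices
     coincide, both pairs are strict. *)
  - destruct (Nat.lt_trichotomy m n) as [mn | [<- | nm]].
    + rewrite Nat.min_l by lia.
      exact (strict_equiv_trans le hle _ _ _ Lm (En m mn)).
    + rewrite Nat.min_id; exact (strict_of_trans le hle _ _ _ Lm Ln).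
    + rewrite Nat.min_r by lia.
      exact (equiv_strict_trans le hle _ _ _ (Em n nm) Ln).
Qed.

Lemma seq_le_refl (hle : preorder K le) (a : seqs K) : seq_le le a a.
Proof. apply seq_leP; left; intros n; apply (equiv_of_refl le hle). Qed.

Lemma seq_le_trans (hle : preorder K le) (a b c : seqs K) :
  seq_le le a b -> seq_le le b c -> seq_le le a c.
Proof.
  rewrite !seq_leP; intros [Eab | Lab] [Ebc | Lbc].
  - left; intros n; exact (equiv_of_trans le hle _ _ _ (Eab n) (Ebc n)).
  (* In the mixed cases the index of the strict pair is kept, since the other two sequences are
     equivalent at every index. *)
  - right; destruct Lbc as [m [E L]]; exists m; split.
    + intros n Hn; exact (equiv_of_trans le hle _ _ _ (Eab n) (E n Hn)).
    + exact (equiv_strict_trans le hle _ _ _ (Eab m) L).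
  - right; destruct Lab as [m [E L]]; exists m; split.
    + intros n Hn; exact (equiv_of_trans le hle _ _ _ (E n Hn) (Ebc n)).
    + exact (strict_equiv_trans le hle _ _ _ L (Ebc m)).
  - right; exact (seq_lt_trans hle a b c Lab Lbc).
Qed.

Lemma seq_le_total (hle : total_preorder le) (a b : seqs K) :
  seq_le le a b \/ seq_le le b a.
Proof.
  rewrite !seq_leP.
  (* Excluded middle is invoked because equivalence quantifies over infinitely many indices. *)
  destruct (classic (seq_equiv le a b)) as [E | nE]; [tauto |].
  destruct (least_counterexample _ nE) as [n0 [E ne]].
  destruct (not_equiv_strict le hle _ _ ne) as [L | L].
  - left; right; exists n0; split; assumption.
  (* The strict pair points from [b] to [a], so the equivalences below [n0] must be reversed. *)
  - right; right; exists n0; split; [| assumption].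
    intros n Hn; apply equiv_of_sym, E, Hn.
Qed.

End SeqLe.

Theorem theorem3p5 (X K : Type) (hX : inhabited X)
    (le : relation K) (hle : total_preorder le) (Phi : X -> seqs K) :
  total_preorder (sequential_rel le Phi).
Proof.
  split.
  - split.
    + intros x; exact (seq_le_refl le (proj1 hle) (Phi x)).
    + intros x y z; exact (seq_le_trans le (proj1 hle) (Phi x) (Phi y) (Phi z)).
  - intros x y; exact (seq_le_total le hle (Phi x) (Phi y)).
Qed.
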